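(* Let $\mathcal{G}$ be the set of all functions $g:\mathbb{N}\to\mathbb{N}$ such that $(g(n))$ is nondecreasing, $\lim_{n}g(n)=\infty$, $\frac{n}{g(n)}$ does not tend to zero, and $\left(\frac{n}{g(n)}\right)$ is nondecreasing. For $g\in\mathcal{G}$ let $\phi_g(C)=\sup_{n\in\mathbb{N}}\frac{|C\cap\{1,2,\ldots,n\}|}{g(n)}$ for $C\subseteq\mathbb{N}$. The following are equivalent for every $g,h\in\mathcal{G}$: (a) $g(n)=O(h(n))$, i.e., there is $\eta>0$ such that $\frac{g(n)}{h(n)}\le\eta$ for all $n\in\mathbb{N}$; (b) $\phi_h\preceq\phi_g$; (c) $\phi_h\preceq_m\phi_g$; (d) $\mathrm{Fin}(\phi_g)\subseteq\mathrm{Fin}(\phi_h)$; (e) $\mathrm{Exh}(\phi_g)\subseteq\mathrm{Exh}(\phi_h)$; (f) $\mathrm{Exh}(\phi_g)\subseteq\mathrm{Fin}(\phi_h)$; (g) $\mathrm{FIN}(\phi_g)\subseteq\mathrm{FIN}(\phi_h)$; (h) $\mathrm{EXH}(\phi_g)\subseteq\mathrm{EXH}(\phi_h)$; (i) $\mathrm{EXH}(\phi_g)\subseteq\mathrm{FIN}(\phi_h)$; (j) $\mathrm{mFIN}(\phi_g)\subseteq\mathrm{mFIN}(\phi_h)$; (k) $\mathrm{mEXH}(\phi_g)\subseteq\mathrm{mEXH}(\phi_h)$; (l) $\mathrm{mEXH}(\phi_g)\subseteq\mathrm{mFIN}(\phi_h)$; (m) $\mathrm{BV}(\phi_g)\s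ubseteq\mathrm{BV}(\phi_h)$.
   Context: $\mathbb{N}=\{1,2,3,\ldots\}$. A submeasure is a function $\phi:\mathcal{P}(\mathbb{N})\to[0,\infty]$ with $\phi(\emptyset)=0$, $\phi(\{n\})<\infty$ for all $n\in\mathbb{N}$, and $\phi(C)\le\phi(C\cup D)\le\phi(C)+\phi(D)$ for all $C,D\subseteq\mathbb{N}$. It is lower semicontinuous (lsc) if $\phi(C)=\lim_{n\to\infty}\phi(C\cap\{1,\ldots,n\})$ for all $C\subseteq\mathbb{N}$. For an lsc submeasure $\phi$ let $\mathcal{M}_\phi$ be the family of all measures $\mu$ on $\mathbb{N}$ (defined on $\mathcal{P}(\mathbb{N})$) with $\mu\le\phi$; $\phi$ is non-pathological if $\phi(C)=\sup\{\mu(C):\mu\in\mathcal{M}_\phi\}$ for all $C\subseteq\mathbb{N}$. The functions $\phi_g$, $g\in\mathcal{G}$, are non-pathological lsc submeasures. Put $\mathrm{Fin}(\phi)=\{C\subseteq\mathbb{N}:\phi(C)<\infty\}$ and $\mathrm{Exh}(\phi)=\{C\subseteq\mathbb{N}:\lim_{n\to\infty}\phi(C\setminus\{1,\ldots,n\})=0\}$. For a non-pathological lsc submeasure $\phi$ and $x=(x_n)\in\mathbb{R}^{\mathbb{N}}$ put $\hat\phi(x)=\sup\{\sum_{n\in\mathbb{N}}\mu(\{n\})|x_n|:\mu\in\mathcal{M}_\phi\}\in[0,\infty]$. For a finite sequence $x$, $\hat\phi(x)$ means $\hat\phi$ of $x$ extended by zeros. Define $\mathrm{FIN}(\phi)=\{x\in\mathbb{R}^{\mathbb{N}}:\hat\phi(x)<\infty\}$,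 $\mathrm{EXH}(\phi)=\{x\in\mathbb{R}^{\mathbb{N}}:\lim_{n\to\infty}\hat\phi(x\cdot\chi_{\{n,n+1,\ldots\}})=0\}$, $\mathrm{Mon}=\{x\in\mathbb{R}^{\mathbb{N}}:|x_{n+1}|\le|x_n|\text{ for all }n\in\mathbb{N}\}$, $\mathrm{mFIN}(\phi)=\mathrm{FIN}(\phi)\cap\mathrm{Mon}$, $\mathrm{mEXH}(\phi)=\mathrm{EXH}(\phi)\cap\mathrm{Mon}$. For non-pathological lsc submeasures $\phi_1,\phi_2$: $\phi_2\preceq\phi_1$ means there is $M>0$ such that $\hat\phi_2(x)\le M\hat\phi_1(x)$ for every finite real sequence $x\in\bigcup_{n\in\mathbb{N}}\mathbb{R}^n$; $\phi_2\preceq_m\phi_1$ means there is $M>0$ such that $\hat\phi_2(x)\le M\hat\phi_1(x)$ for every finite real sequence $x=(x_1,\ldots,x_n)$, $n\in\mathbb{N}$, with $|x_1|\ge|x_2|\ge\cdots\ge|x_n|$. Let $I=[0,1]$, let $B(I)$ be the set of bounded functions $x:I\to\mathbb{R}$, and let $\mathcal{P}_I$ be the set of all sequences $J=(J_n)_{n\in\mathbb{N}}$ of nonoverlapping (pairwise disjoint interiors) closed subintervals of $I$, possibly degenerate to single points. For $x:I\to\mathbb{R}$ and $J_n=[s_n,t_n]$ put $|x(J_n)|=|x(t_n)-x(s_n)|$ and let $x(J)$ denote the sequence $(|x(J_n)|)_{n\in\mathbb{N}}$. Define $\mathrm{BV}(\phi)=\{x\in B(I):\sup_{J\in\mathcal{P}_I}\hat\phi(x(J))<\infty\}$.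 *)

(* Defs.v *)
From HB Require Import structures.
From mathcomp Require Import all_boot all_order all_algebra.
From mathcomp Require Import finmap.
From mathcomp Require Import all_classical all_reals all_analysis.

Set Implicit Arguments.
Unset Strict Implicit.
Unset Printing Implicit Defensive.

Import Order.TTheory GRing.Theory Num.Theory.
Import numFieldNormedType.Exports.

Local Open Scope classical_set_scope.
Local Open Scope ring_scope.

(* Indexing convention: the index set {1, 2, 3, ...} is represented by [nat],
   with [i : nat] standing for the integer [i.+1].  Thus {1, ..., n} is
   [`I_n = [set i | i < n]], a sequence (x_n)_{n >= 1} is the function sending
   [i] to x_(i+1), and a function g on {1, 2, ...} is represented by the
   function sending [i] to g(i+1).  Values of g are not shifted: they are
   ordinary naturals, required to be positive. *)

Section submeasures.
Variable R : realType.
Implicit Types (phi psi : set nat -> \bar R) (x : nat -> R).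

Definition submeasure phi : Prop :=
  [/\ phi set0 = 0%E,
      forall C, (0 <= phi C)%E,
      forall n, (phi [set n] < +oo)%E,
      forall C D, (phi C <= phi (C `|` D))%E
    & forall C D, (phi (C `|` D) <= phi C + phi D)%E].

Definition lsc phi : Prop :=
  forall C, phi (C `&` `I_n) @[n --> \oo] --> phi C.

Definition dominated_measures phi : set {measure set nat -> \bar R} :=
  [set mu | forall C, (mu C <= phi C)%E].

Definition non_pathological phi : Prop :=
  forall C, phi C = ereal_sup
    [set (mu : {measure set nat -> \bar R}) C | mu in dominated_measures phi].

Definition np_lsc_submeasure phi : Prop :=
  [/\ submeasure phi, lsc phi & non_pathological phi].

Definition Fin phi : set (set nat) := [set C | (phi C < +oo)%E].

Definition Exh phi : set (set nat) :=
  [set C | phi (C `\` `I_n) @[n --> \oo] --> 0%E].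

Definition hat phi x : \bar R :=
  ereal_sup [set (\sum_(n <oo) mu [set n] * `|x n|%:E)%E
            | mu in dominated_measures phi].

Definition FIN phi : set (nat -> R) := [set x | (hat phi x < +oo)%E].

Definition EXH phi : set (nat -> R) :=
  [set x | hat phi (fun k => x k * \1_[set i | (n <= i)%N] k)
           @[n --> \oo] --> 0%E].

Definition Mon : set (nat -> R) := [set x | forall n, `|x n.+1| <= `|x n|].

Definition mFIN phi : set (nat -> R) := FIN phi `&` Mon.

Definition mEXH phi : set (nat -> R) := EXH phi `&` Mon.

Definition zero_ext (n : nat) (x : n.-tuple R) : nat -> R :=
  fun i => nth 0 x i.

(* The lengths n >= 1 of finite sequences are written [n.+1]. *)
Definition preceq psi phi : Prop :=
  exists2 M : R, 0 < M & forall (n : nat) (x : n.+1.-tuple R),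
    (hat psi (zero_ext x) <= M%:E * hat phi (zero_ext x))%E.

Definition preceq_m psi phi : Prop :=
  exists2 M : R, 0 < M & forall (n : nat) (x : n.+1.-tuple R),
    (forall i j : 'I_n.+1, (i <= j)%N -> `|tnth x j| <= `|tnth x i|) ->
    (hat psi (zero_ext x) <= M%:E * hat phi (zero_ext x))%E.

(* [J n = (s, t)] encodes the closed interval [s, t], with s = t allowed. *)
Definition nonoverlapping : set (nat -> R * R) :=
  [set J : nat -> R * R |
    (forall n, [/\ 0 <= (J n).1, (J n).1 <= (J n).2 & (J n).2 <= 1]) /\
    trivIset [set: nat] (fun n => (`[(J n).1, (J n).2] : set R)°)].

Definition increments (x : R -> R) (J : nat -> R * R) : nat -> R :=
  fun n => `|x (J n).2 - x (J n).1|.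

(* A function on [0, 1] is represented by a total function on R; only its
   values on [0, 1] are constrained. *)
Definition BVar phi : set (R -> R) :=
  [set x | [bounded x t | t in `[0, 1]] /\
           (ereal_sup [set hat phi (increments x J) | J in nonoverlapping]
              < +oo)%E].

Definition calG : set (nat -> nat) :=
  [set g | [/\ forall n, (0 < g n)%N,
               {homo g : m n / (m <= n)%N},
               g @ \oo --> \oo,
               ~ ((n.+1%:R / (g n)%:R : R) @[n --> \oo] --> (0 : R))
             & {homo (fun n => n.+1%:R / (g n)%:R : R) :
                 m n / (m <= n)%N >-> m <= n}]].

Definition phi_ (g : nat -> nat) (C : set nat) : \bar R :=
  ereal_sup (range (fun n =>
    ((#|` fset_set (C `&` `I_n.+1)|)%:R / (g n)%:R : R)%:E)).

End submeasures.

Section phi_np_lsc.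
Variable R : realType.
Implicit Types (g : nat -> nat) (C D : set nat) (n k : nat).

Let mI n : measurable (`I_n.+1 : set nat). Proof. by []. Qed.

Let ginv_ge0 g n : 0 <= ((g n)%:R^-1 : R).
Proof. by rewrite invr_ge0. Qed.

Definition phi_measure g n : {measure set nat -> \bar R} :=
  mscale (NngNum (ginv_ge0 g n)) (mrestr (@counting nat R) (@mI n)).

Lemma phi_measureE g n C : phi_measure g n C =
  ((#|` fset_set (C `&` `I_n.+1)|)%:R / (g n)%:R : R)%:E.
Proof.
rewrite /phi_measure /= /mscale /= /mrestr /counting asboolT; last first.
  exact/finite_setIr/finite_II.
by rewrite -EFinM mulrC.
Qed.

Lemma phi_E g C : phi_ R g C = ereal_sup (range (fun n => phi_measure g n C)).
Proof.
by congr ereal_sup; apply: eq_imagel => n _; rewrite phi_measureE.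
Qed.

Lemma phi_measure_dominated g n :
  dominated_measures (phi_ R g) (phi_measure g n).
Proof. by move=> C; rewrite phi_E; apply: ereal_sup_ubound; exists n. Qed.

Lemma phi_np_lsc_submeasure g : np_lsc_submeasure (phi_ R g).
Proof.
have phi_mono C D : C `<=` D -> (phi_ R g C <= phi_ R g D)%E.
  move=> CD; rewrite phi_E; apply: ge_ereal_sup => _ [n _ <-].
  apply: le_trans (phi_measure_dominated g n D).
  by apply: le_measure; rewrite ?inE.
have phi_ge0 C : (0 <= phi_ R g C)%E.
  exact: le_trans (measure_ge0 _ _) (phi_measure_dominated g 0 C).
split; first split.
- apply/eqP; rewrite eq_le phi_ge0 andbT phi_E.
  by apply: ge_ereal_sup => _ [n _ <-]; rewrite measure0.
- exact: phi_ge0.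
- move=> k; apply: (@le_lt_trans _ _ 1%E); last exact: ltry.
  apply: ge_ereal_sup => _ [n _ <-].
  have cle : (#|` fset_set ([set k] `&` `I_n.+1)| <= 1)%N.
    rewrite -(cardfs1 k); apply: fsubset_leq_card.
    rewrite -fset_set1 -fset_set_sub//; last exact: finite_setIl.
  rewrite lee_fin; have [->|g0] := posnP (g n); first by rewrite invr0 mulr0.
  rewrite ler_pdivrMr ?ltr0n// mul1r ler_nat.
  exact: leq_trans cle g0.
- by move=> C D; apply: phi_mono; exact: subsetUl.
- move=> C D; rewrite [leLHS]phi_E; apply: ge_ereal_sup => _ [n _ <-].
  apply: le_trans (@measureU2 _ _ _ (phi_measure g n) C D _ _) _ => //.
  by apply: leeD; exact: phi_measure_dominated.
- move=> C.
  have nd : nondecreasing_seq (fun n => phi_ R g (C `&` `I_n)).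
    move=> m n mn; apply: phi_mono; apply: setIS => i /=.
    by move=> /leq_trans; apply.
  suff -> : phi_ R g C = ereal_sup (range (fun n => phi_ R g (C `&` `I_n))).
    exact: ereal_nondecreasing_cvgn.
  apply/eqP; rewrite eq_le; apply/andP; split.
    rewrite phi_E; apply: ge_ereal_sup => _ [n _ <-].
    apply: le_ereal_sup_tmp; exists (phi_ R g (C `&` `I_n.+1)).
      by exists n.+1.
    apply: le_trans (phi_measure_dominated g n _).
    by rewrite !phi_measureE -setIA setIid.
  by apply: ge_ereal_sup => _ [n _ <-]; apply: phi_mono; exact: subIsetl.
- move=> C; apply/eqP; rewrite eq_le; apply/andP; split.
    rewrite phi_E; apply: ereal_sup_le => _ [n _ <-].
    by exists (phi_measure g n) => //; exact: phi_measure_dominated.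
  by apply: ge_ereal_sup => _ [mu mu_phi <-]; exact: mu_phi.
Qed.

End phi_np_lsc.

(* Main.v *)
Require Import Defs.
From mathcomp Require Import all_boot all_order all_algebra.
From mathcomp Require Import finmap.
From mathcomp Require Import all_classical all_reals all_analysis.
From mathcomp Require Import lra ring zify.
Import Order.TTheory GRing.Theory Num.Theory.
Import numFieldNormedType.Exports.
Local Open Scope classical_set_scope.
Local Open Scope ring_scope.

(** If [g <= eta * h] then [phi_h <= eta * phi_g], so dividing a measure
    below [phi_h] by [eta] gives one below [phi_g], and the extensions to
    sequences satisfy the same inequality ([hat_scale]).  Every other condition
    follows at once.

    Conversely, testing on the constant sequence 1 of length [n] recovers
    [g n / h n <= M] from the comparison on monotone sequences, because
    [phi_g] takes the value [n / g n] on an initial segment of length [n] and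
    at most that value on any set with [n] elements ([phi_le_card]); this
    uses the monotonicity of both [g] and [n / g n].

    The inclusions are handled by a gliding hump.  If [g / h] is unbounded,
    choose indices [n_k] along which it grows so fast that, for
    [c_k = (k+1) h(n_k)], the ratios [c_k / g(n_k)] and [c_k / n_k] are both
    below [2^-k] ([exists_sparse]).  A hump of size [c_k / g(n_k)] for [phi_g],
    up to a factor 2, then has size [c_k / h(n_k) = k + 1] for [phi_h], so a
    superposition of the humps is small for [phi_g] ([hat_le_series],
    [EXH_hump]) and infinite for [phi_h].  The hump depends on the kind of
    object wanted:
    - for sets, the [c_k] consecutive integers ending at [n_k]; as they lie in
      the upper half of [1, n_k], their [phi_g]-size is at most
      [2 c_k / g(n_k)];
    - for monotone sequences, the value [c_k / n_k] on the first [n_k] integers;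
    - for functions on the unit interval, the value [c_k / n_k] on the [n_k]
      largest of the points [1 / (2i+1)].  Nonoverlapping intervals can use a
      given point at most twice as an endpoint, so the increments of the [k]-th
      hump along any family of intervals live on at most [2 n_k] indices,
      whereas the intervals from [1 / (2i+2)] to [1 / (2i+1)] read off the
      monotone sequence itself.

    The inclusion of exhaustive objects in finite ones ([EXH_FIN]) and the
    identity between the extension and the submeasure on indicators
    ([hat_indic]) link the remaining conditions to these three. *)

(** * The extension of a submeasure to real sequences *)

Lemma measure_indic (R : realType) (mu : {measure set nat -> \bar R})
    (C : set nat) :
  mu C = (\sum_(i <oo) mu [set i] * (\1_C i)%:E)%E.
Proof.
rewrite -[in LHS](image_id C) -(bigcup_imset1 C id).
rewrite (@measure_bigcup _ _ _ mu C (fun i => [set i])) //.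
- rewrite eseries_mkcond; apply: eq_eseriesr => i _; rewrite indicE.
  by case: ifP => _; rewrite ?mule1 ?mule0.
- by move=> i j _ _ [k [-> ->]].
Qed.

Lemma dominated_fin_num (R : realType) (phi : set nat -> \bar R)
    (mu : {measure set nat -> \bar R}) (i : nat) :
  submeasure phi -> dominated_measures phi mu -> mu [set i] \is a fin_num.
Proof.
move=> [_ _ phi_fin _ _] mu_phi; rewrite ge0_fin_numE//.
exact: le_lt_trans (mu_phi _) (phi_fin i).
Qed.

Lemma hat_ge0 (R : realType) (phi : set nat -> \bar R) (x : nat -> R) :
  submeasure phi -> (0 <= hat phi x)%E.
Proof.
move=> [_ phi_ge0 _ _ _]; apply: ereal_sup_ubound.
exists mzero => [C|]; first exact: phi_ge0.
by rewrite eseries0// => i _ _; rewrite mul0e.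
Qed.

(** Countable subadditivity: against a fixed dominated measure the two sums can
    be exchanged, since all terms are nonnegative. *)
Lemma hat_le_series (R : realType) (phi : set nat -> \bar R) (x a : nat -> R)
    (C : nat -> set nat) :
  submeasure phi -> (forall k, 0 <= a k) ->
  (forall i, (`|x i|%:E <= \sum_(k <oo) (a k * \1_(C k) i)%:E)%E) ->
  (hat phi x <= \sum_(k <oo) (a k)%:E * phi (C k))%E.
Proof.
move=> phi_sub a_ge0 x_le; apply: ge_ereal_sup => _ [mu mu_phi <-].
have mu_fin i := dominated_fin_num _ _ _ i phi_sub mu_phi.
have a1_ge0 k i : (0 <= (a k * \1_(C k) i)%:E)%E.
  by rewrite lee_fin mulr_ge0.
have mu_ge0 A : (0 <= mu A)%E by exact: measure_ge0.
apply: (@le_trans _ _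
    (\sum_(i <oo) \sum_(k <oo) mu [set i] * (a k * \1_(C k) i)%:E)%E).
  apply: lee_nneseries => [i _ _|i _]; first by rewrite mule_ge0.
  rewrite -(fineK (mu_fin i)) nneseriesZl//.
  by apply: lee_wpmul2l; rewrite ?x_le// fineK.
rewrite nneseries_interchange => [|i k]; last by rewrite mule_ge0.
apply: lee_nneseries => [k _ _|k _].
  by apply: nneseries_ge0 => i _ _; rewrite mule_ge0.
under eq_eseriesr do rewrite EFinM muleCA.
rewrite nneseriesZl => [|i _]; last by rewrite mule_ge0 ?lee_fin.
by rewrite -measure_indic lee_wpmul2l ?lee_fin.
Qed.

Lemma hat_ge (R : realType) (phi : set nat -> \bar R) (x : nat -> R)
    (mu : {measure set nat -> \bar R}) (a : R) (C : set nat) :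
  dominated_measures phi mu -> 0 <= a -> (forall i, C i -> a <= `|x i|) ->
  (a%:E * mu C <= hat phi x)%E.
Proof.
move=> mu_phi a_ge0 x_ge.
apply: (@le_trans _ _ (\sum_(i <oo) mu [set i] * `|x i|%:E)%E); last first.
  by apply: ereal_sup_ubound; exists mu.
rewrite measure_indic.
rewrite -nneseriesZl => [|i _]; last by rewrite mule_ge0 ?lee_fin.
apply: lee_nneseries => [i _ _|i _]; first by rewrite !mule_ge0 ?lee_fin.
rewrite muleCA; apply: lee_wpmul2l => //; rewrite -EFinM lee_fin indicE.
case: (boolP (i \in C)) => [|_]; last by rewrite mulr0.
by rewrite inE mulr1 => /x_ge.
Qed.

(** Non-pathology says exactly that the supremum over dominated measures
    recovers the submeasure, and it makes sets a special case of sequences. *)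
Lemma hat_indic (R : realType) (phi : set nat -> \bar R) (C : set nat) :
  np_lsc_submeasure phi -> hat phi (\1_C : nat -> R) = phi C.
Proof.
move=> [phi_sub _ phi_np]; apply/eqP; rewrite eq_le; apply/andP; split.
  apply: ge_ereal_sup => _ [mu mu_phi <-].
  under eq_eseriesr do rewrite ger0_norm//.
  by rewrite -measure_indic; exact: mu_phi.
rewrite phi_np; apply: ge_ereal_sup => _ [mu mu_phi <-].
rewrite -[leLHS]mul1e; apply: hat_ge => // i Ci.
by rewrite indicE mem_set// normr1.
Qed.

Lemma Fin_indic (R : realType) (phi : set nat -> \bar R) (C : set nat) :
  np_lsc_submeasure phi -> Fin phi C = FIN phi (\1_C : nat -> R).
Proof. by move=> phi_np; rewrite /FIN /= hat_indic. Qed.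

Lemma Exh_indic (R : realType) (phi : set nat -> \bar R) (C : set nat) :
  np_lsc_submeasure phi -> Exh phi C = EXH phi (\1_C : nat -> R).
Proof.
move=> phi_np; rewrite /EXH /Exh /=.
suff -> : (fun n => phi (C `\` `I_n)) =
  (fun n => hat phi (fun k => \1_C k * \1_[set i | (n <= i)%N] k : R)) by [].
apply/funext => n; rewrite -hat_indic//; congr hat.
apply/funext => i; rewrite setDE indicI /=; congr (_ * \1_ _ i).
by apply/seteqP; split => j /=; rewrite (leqNgt n j) => /negP.
Qed.

(** One tail has finite size, and the finitely many terms before it contribute
    finitely much because singletons have finite submeasure. *)
Lemma EXH_FIN (R : realType) (phi : set nat -> \bar R) :
  submeasure phi -> EXH phi `<=` FIN phi.
Proof.
move=> phi_sub x; rewrite /EXH /FIN /= => x_exh.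
have [_ phi_ge0 phi_fin _ _] := phi_sub.
pose t n k := x k * \1_[set i | (n <= i)%N] k.
have [n tn] : exists n, hat phi (t n) \is a fin_num.
  by have /fine_cvgP[[n _ /(_ n (leqnn n)) tn] _] := x_exh; exists n.
apply: (@le_lt_trans _ _
    (\sum_(0 <= i < n) phi [set i] * `|x i|%:E + hat phi (t n))%E).
  apply: ge_ereal_sup => _ [mu mu_phi <-].
  rewrite (@nneseries_split _ _ 0 n) ?add0n => [|k _]; last first.
    by rewrite mule_ge0 ?lee_fin.
  apply: leeD.
    by apply: lee_sum => i _; rewrite lee_wpmul2r ?lee_fin.
  apply: (@le_trans _ _ (\sum_(i <oo) mu [set i] * `|t n i|%:E)%E); last first.
    by apply: ereal_sup_ubound; exists mu.
  rewrite (@nneseries_split _ (fun i => mu [set i] * `|t n i|%:E)%E 0 n).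
    rewrite add0n; apply: le_trans (leeDr _ _); last first.
      by apply: sume_ge0 => i _; rewrite mule_ge0 ?lee_fin.
    rewrite -!(@nneseries_addn _ _ n) => [|k|k];
      try by rewrite mule_ge0 ?lee_fin.
    apply: lee_nneseries => [k _ _|k _]; first by rewrite mule_ge0 ?lee_fin.
    by rewrite /t indicE mem_set ?mulr1//= leq_addl.
  by move=> k _; rewrite mule_ge0 ?lee_fin.
rewrite lte_add_pinfty ?ltey_eq ?tn// -ltey_eq lte_sum_pinfty// => i _.
rewrite lte_mul_pinfty ?ltry//.
by rewrite ge0_fin_numE.
Qed.

(** Division by [eta] maps the measures dominated by [psi] to measures
    dominated by [phi]. *)
Lemma hat_scale (R : realType) (phi psi : set nat -> \bar R) (eta : R)
    (x : nat -> R) :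
  0 < eta -> (forall C, (psi C <= eta%:E * phi C)%E) ->
  (hat psi x <= eta%:E * hat phi x)%E.
Proof.
move=> eta_gt0 psi_le; apply: ge_ereal_sup => _ [mu mu_psi <-].
have eta'_ge0 : 0 <= eta^-1 by rewrite invr_ge0 ltW.
rewrite -lee_pdivrMl// -nneseriesZl => [|i _]; last first.
  by rewrite mule_ge0 ?lee_fin.
apply: ereal_sup_ubound; exists (mscale (NngNum eta'_ge0) mu) => [C|].
  by rewrite /= /mscale/= lee_pdivrMl//; exact: le_trans (mu_psi C) _.
by apply: eq_eseriesr => i _; rewrite muleA.
Qed.

Lemma cvge0P (R : realType) (u : nat -> \bar R) : (forall n, (0 <= u n)%E) ->
  u @ \oo --> 0%E <->
  forall e : R, 0 < e -> \forall n \near \oo, (u n <= e%:E)%E.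
Proof.
move=> u_ge0; split => [/fine_cvgP[u_fin /cvgrPdist_le u_cvg] e e_gt0|u_le].
  near=> n.
  have un_fin : u n \is a fin_num by near: n.
  rewrite -(fineK un_fin) lee_fin.
  have : `|0 - fine (u n)| <= e by near: n; exact: u_cvg.
  by rewrite sub0r normrN ger0_norm ?fine_ge0.
have u_fin n e : (u n <= e%:E)%E -> u n \is a fin_num.
  by move=> une; rewrite ge0_fin_numE//; exact: le_lt_trans une (ltry _).
apply/fine_cvgP; split; first by apply: filterS (u_le 1 ltr01) => n /u_fin.
apply/cvgrPdist_le => e e_gt0; apply: filterS (u_le e e_gt0) => n une.
by rewrite sub0r normrN ger0_norm ?fine_ge0// -lee_fin fineK// (u_fin _ e).
Unshelve. all: by end_near. Qed.

(** Each hump lies in a bounded part of the index set, so beyond a suitable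
    index the first [K] humps vanish and the rest is controlled by the tail of
    a convergent series. *)
Lemma EXH_hump (R : realType) (phi : set nat -> \bar R) (x a : nat -> R)
    (C : nat -> set nat) (m : nat -> nat) :
  submeasure phi -> (forall k, 0 <= a k) ->
  (forall i, (`|x i|%:E <= \sum_(k <oo) (a k * \1_(C k) i)%:E)%E) ->
  (forall k, C k `<=` `I_(m k)) ->
  (\sum_(k <oo) (a k)%:E * phi (C k) < +oo)%E ->
  EXH phi x.
Proof.
move=> phi_sub a_ge0 x_le Cm sum_fin.
have [_ phi_ge0 _ _ _] := phi_sub.
have aphi_ge0 k : (0 <= (a k)%:E * phi (C k))%E by rewrite mule_ge0 ?lee_fin.
rewrite /EXH /=; apply/cvge0P => [n|e e_gt0]; first exact: hat_ge0.
have /cvge0P/(_ e e_gt0)[|K _ /(_ K (leqnn K)) K_tail] :=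
    nneseries_tail_cvg sum_fin (fun k _ => aphi_ge0 k).
  by move=> n; apply: nneseries_ge0.
exists (\max_(k < K) m k)%N => // n /= mn.
apply: le_trans K_tail.
rewrite -nneseries_addn//.
apply: (@hat_le_series _ _ _
  (fun k => a (k + K)%N) (fun k => C (k + K)%N)) => // i.
have a1_ge0 k : (0 <= (a k * \1_(C k) i)%:E)%E by rewrite lee_fin mulr_ge0.
rewrite indicE; case: (boolP (_ \in _)) => [|_]; last first.
  by rewrite mulr0 normr0 nneseries_ge0.
rewrite inE mulr1 /= => ni; apply: le_trans (x_le i) _.
rewrite (@nneseries_split _ _ 0 K)// add0n.
rewrite -(@nneseries_addn _ (fun k => (a k * \1_(C k) i)%:E) K)//.
rewrite big_nat big1 ?add0e// => k /andP[_ kK].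
rewrite indicE memNset ?mulr0// => /Cm /=; apply/negP; rewrite -leqNgt.
apply: leq_trans ni; apply: leq_trans mn.
exact: (leq_bigmax (Ordinal kK)).
Qed.

(** * The submeasures [phi_g] on initial segments and blocks *)

Lemma phi_submeasure (R : realType) g : submeasure (phi_ R g).
Proof. by have [] := phi_np_lsc_submeasure R g. Qed.

Lemma phi_scale (R : realType) g h (eta : R) C : (forall n, 0 < g n)%N ->
  0 < eta -> (forall n, (g n)%:R / (h n)%:R <= eta) ->
  (phi_ R h C <= eta%:E * phi_ R g C)%E.
Proof.
move=> g_gt0 eta_gt0 gh; apply: ge_ereal_sup => _ [n _ <-].
apply: (@le_trans _ _ (eta%:E * phi_measure R g n C)%E); last first.
  apply: lee_wpmul2l; first by rewrite lee_fin ltW.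
  exact: phi_measure_dominated.
rewrite phi_measureE -EFinM lee_fin mulrCA ler_wpM2l//.
by rewrite ler_pdivlMr ?ltr0n// mulrC.
Qed.

(** The quotient [min (m, n) / g m] is largest at [m = n]: it increases up to
    [n] because [m / g m] does, and decreases afterwards because [g]
    increases. *)
Lemma phi_le_card (R : realType) g n (B : set nat) :
  calG R g -> (B #<= `I_n.+1)%card -> (phi_ R g B <= (n.+1%:R / (g n)%:R)%:E)%E.
Proof.
move=> [g_gt0 g_mono _ _ ng_mono] Bn.
apply: ge_ereal_sup => _ [m _ <-]; rewrite lee_fin.
have [mn|nm] := leqP m n.
  apply: le_trans (ng_mono _ _ mn); rewrite ler_wpM2r ?invr_ge0// ler_nat.
  by apply: geq_card_fset_set; apply: subset_card_le; exact: subIsetr.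
apply: (@le_trans _ _ (n.+1%:R / (g m)%:R)).
  rewrite ler_wpM2r ?invr_ge0// ler_nat.
  apply: geq_card_fset_set; apply: card_le_trans Bn.
  by apply: subset_card_le; exact: subIsetl.
by rewrite ler_wpM2l// lef_pV2 ?posrE ?ltr0n// ler_nat g_mono// ltnW.
Qed.

(** An interval of indices ending at [n], presented as the image of an initial
    segment so that its cardinality can be read off. *)
Definition block n c : set nat := (subn n) @` `I_c.

(** The block sits in the upper half of the indices up to [n], so only initial
    segments longer than half of that meet it; for those [g m >= g n / 2],
    because [g m / m] is nonincreasing. *)
Lemma phi_block_le (R : realType) g n c : calG R g -> (c.*2 <= n.+1)%N ->
  (phi_ R g (block n c) <= (c.*2%:R / (g n)%:R)%:E)%E.
Proof.
move=> [g_gt0 g_mono _ _ ng_mono] cn.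
apply: ge_ereal_sup => _ [m _ <-]; rewrite lee_fin.
have card_c : (#|` fset_set (block n c `&` `I_m.+1)| <= c)%N.
  apply: geq_card_fset_set; apply: (card_le_trans _ (card_image_le (subn n) _)).
  by apply: subset_card_le; exact: subIsetl.
have [mcn|ncm] := leqP (m + c) n.
  rewrite (_ : _ `&` _ = set0) ?fset_set0 ?cardfs0 ?mul0r ?divr_ge0//.
  by apply/seteqP; split => // i /= [[j /= jc <-]] ?; lia.
apply: (@le_trans _ _ (c%:R / (g m)%:R)).
  by rewrite ler_wpM2r ?invr_ge0// ler_nat.
have [mn|nm] := leqP m n; last first.
  apply: (@le_trans _ _ (c%:R / (g n)%:R)).
    by rewrite ler_wpM2l// lef_pV2 ?posrE ?ltr0n// ler_nat g_mono// ltnW.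
  by rewrite ler_wpM2r ?invr_ge0// ler_nat -addnn leq_addr.
have := ng_mono _ _ mn.
rewrite ler_pdivrMr ?ltr0n// mulrAC ler_pdivlMr ?ltr0n// -!natrM ler_nat => gm.
rewrite ler_pdivrMr ?ltr0n// mulrAC ler_pdivlMr ?ltr0n// -!natrM ler_nat.
(* Here [m] lies inside the block, hence in the upper half of the indices. *)
have m2 : (n.+1 <= m.+1.*2)%N by lia.
rewrite -(leq_pmul2l (ltn0Sn m)); nia.
Qed.

Lemma phi_block_ge (R : realType) h n c : (c <= n.+1)%N ->
  ((c%:R / (h n)%:R)%:E <= phi_ R h (block n c))%E.
Proof.
move=> cn; apply: le_trans (phi_measure_dominated R h n _).
rewrite phi_measureE lee_fin ler_wpM2r ?invr_ge0// ler_nat.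
apply: leq_card_fset_set; first exact/finite_setIr/finite_II.
rewrite setIidl => [|_ [j _ <-]]; last by rewrite /= ltnS leq_subr.
rewrite (card_le_eqr (inj_card_eq _))// => i j; rewrite !inE /= => ic jc; lia.
Qed.

Lemma phi_measure_initial (R : realType) h n :
  phi_measure R h n `I_n.+1 = (n.+1%:R / (h n)%:R)%:E.
Proof. by rewrite phi_measureE setIid (card_fset_set (card_eqxx _)). Qed.

(** * Superposition of humps *)

Lemma nneseries_term_le (R : realType) (u : nat -> \bar R) k :
  (forall i, (0 <= u i)%E) -> (u k <= \sum_(i <oo) u i)%E.
Proof.
move=> u_ge0; rewrite (@nneseriesD1 _ _ k)// leeDl//.
exact: nneseries_ge0.
Qed.

Lemma nneseries_half_le (R : realType) (u : nat -> \bar R) :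
  (forall k, (0 <= u k)%E) -> (forall k, (u k <= ((2 ^ k.+1)%:R^-1)%:E)%E) ->
  (\sum_(k <oo) u k <= 1)%E.
Proof.
move=> u_ge0 u_le; have := @cvg_geometric_eseries_half R 1 0.
rewrite expr0 invr1 mulr1 => /cvg_lim <- //.
by apply: lee_nneseries => // k _; rewrite addn1 div1r.
Qed.

Lemma not_lty_of_nat_le (R : realType) (u : \bar R) :
  (forall k : nat, ((k%:R)%:E <= u)%E) -> ~ (u < +oo)%E.
Proof.
case: u => [r u_ge _|//|/(_ 0%N)//].
have := u_ge (Num.truncn r).+1; rewrite lee_fin leNgt.
by rewrite truncnS_gt.
Qed.

(** Summable superposition of multiples of indicators.  The index type is left
    free: natural numbers for monotone sequences, reals for functions on the
    unit interval, which makes the two constructions comparable through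
    inclusions between the [E k]. *)
Definition staircase {R : realType} {T : Type} (a : nat -> R) (E : nat -> set T)
    (t : T) : R :=
  fine (\sum_(k <oo) (a k * \1_(E k) t)%:E).

Lemma staircase_series_le1 (R : realType) (T : Type) (a : nat -> R)
    (E : nat -> set T) (t : T) :
  (forall k, 0 <= a k <= (2 ^ k.+1)%:R^-1) ->
  (\sum_(k <oo) (a k * \1_(E k) t)%:E <= 1)%E.
Proof.
move=> a_le; apply: nneseries_half_le => k.
  by case/andP: (a_le k) => a_ge0 _; rewrite lee_fin mulr_ge0.
case/andP: (a_le k) => a_ge0; rewrite lee_fin; apply: le_trans.
by rewrite ler_piMr// indicE lern1 leq_b1.
Qed.

Lemma staircaseE (R : realType) (T : Type) (a : nat -> R) (E : nat -> set T)
    (t : T) :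
  (forall k, 0 <= a k <= (2 ^ k.+1)%:R^-1) ->
  (staircase a E t)%:E = (\sum_(k <oo) (a k * \1_(E k) t)%:E)%E.
Proof.
move=> a_le; rewrite fineK// ge0_fin_numE.
  exact: le_lt_trans (staircase_series_le1 _ _ _ _ _ a_le) (ltry 1).
apply: nneseries_ge0 => k _ _.
by case/andP: (a_le k) => a_ge0 _; rewrite lee_fin mulr_ge0.
Qed.

Lemma staircase_ge0 (R : realType) (T : Type) (a : nat -> R)
    (E : nat -> set T) (t : T) :
  (forall k, 0 <= a k <= (2 ^ k.+1)%:R^-1) -> 0 <= staircase a E t.
Proof.
move=> a_le; apply/fine_ge0/nneseries_ge0 => k _ _.
by case/andP: (a_le k) => a_ge0 _; rewrite lee_fin mulr_ge0.
Qed.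

Lemma staircase_le1 (R : realType) (T : Type) (a : nat -> R)
    (E : nat -> set T) (t : T) :
  (forall k, 0 <= a k <= (2 ^ k.+1)%:R^-1) -> staircase a E t <= 1.
Proof.
by move=> a_le; rewrite -lee_fin staircaseE//; exact: staircase_series_le1.
Qed.

Lemma staircase_ge (R : realType) (T : Type) (a : nat -> R)
    (E : nat -> set T) (t : T) k :
  (forall k, 0 <= a k <= (2 ^ k.+1)%:R^-1) -> E k t -> a k <= staircase a E t.
Proof.
move=> a_le Et; rewrite -lee_fin staircaseE//.
apply: le_trans (nneseries_term_le _ _ k _) => [|i].
  by rewrite indicE mem_set// mulr1.
by case/andP: (a_le i) => a_ge0 _; rewrite lee_fin mulr_ge0.
Qed.

(** Comparing two superpositions over different types transports values of a
    function on the unit interval to values of a sequence. *)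
Lemma le_staircase (R : realType) (T U : Type) (a : nat -> R)
    (E : nat -> set T) (F : nat -> set U) (s : T) (t : U) :
  (forall k, 0 <= a k <= (2 ^ k.+1)%:R^-1) ->
  (forall k, E k s -> F k t) -> staircase a E s <= staircase a F t.
Proof.
move=> a_le EF; rewrite -lee_fin !staircaseE//.
have a_ge0 k : 0 <= a k by case/andP: (a_le k).
apply: lee_nneseries => [k _ _|k _]; rewrite lee_fin ?mulr_ge0//.
rewrite ler_wpM2l// !indicE ler_nat.
by case: (boolP (s \in E k)) => //; rewrite inE => /EF/mem_set ->.
Qed.

Lemma staircase_eq0 (R : realType) (T : Type) (a : nat -> R)
    (E : nat -> set T) (t : T) :
  (forall k, ~ E k t) -> staircase a E t = 0.
Proof.
move=> Et; rewrite /staircase eseries0// => k _ _.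
by rewrite indicE memNset// mulr0.
Qed.

(** * Objects separating two submeasures with unbounded ratio *)

Lemma ratio_bounded_or_sparse (R : realType) (g h : nat -> nat) :
  (forall n, 0 < h n)%N ->
  (exists2 eta : R, 0 < eta & forall n, (g n)%:R / (h n)%:R <= eta) \/
  (forall D, exists n, (D * h n <= g n)%N).
Proof.
move=> h_gt0; have [|] := pselect (forall D, exists n, (D * h n <= g n)%N).
  by right.
move=> /existsNP[D /forallNP D_gt]; left.
exists D.+1%:R; first by rewrite ltr0n.
move=> n; rewrite ler_pdivrMr ?ltr0n// -natrM ler_nat.
by have /negP := D_gt n; rewrite -ltnNge => /ltnW; nia.
Qed.

(** With [c = (k + 1) * h (n_ k)], both [2 * c / g (n_ k)] and
    [2 * c / (n_ k + 1)] are at most [2 ^ - (k + 1)].  The factor 2 absorbs the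
    loss for blocks and the two endpoints of an interval. *)
Definition sparse_spec (g h n_ : nat -> nat) : Prop := forall k,
  (2 ^ k.+1 * (k.+1 * h (n_ k)).*2 <= (n_ k).+1)%N /\
  (2 ^ k.+1 * (k.+1 * h (n_ k)).*2 <= g (n_ k))%N.

(** Since [n / g n] is nondecreasing, [g n <= g 0 * (n + 1)] with the shifted
    indices; asking for an extra factor [g 0] in the ratio thus gives smallness
    relative to [n] for free. *)
Lemma exists_sparse (R : realType) (g h : nat -> nat) :
  calG R g -> (forall D, exists n, (D * h n <= g n)%N) ->
  exists n_ : nat -> nat, sparse_spec g h n_.
Proof.
move=> [g_gt0 _ _ _ ng_mono] sparse.
have /choice[n_ n_P] k := sparse (g 0 * (2 ^ k.+1 * k.+1.*2))%N.
exists n_ => k; have := n_P k.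
rewrite (_ : (2 ^ k.+1 * (k.+1 * h (n_ k)).*2 =
  2 ^ k.+1 * k.+1.*2 * h (n_ k))%N); last by rewrite -!mul2n; ring.
rewrite -mulnA; set c := (_ * h _)%N => c_le.
have := ng_mono _ _ (leq0n (n_ k)).
rewrite ler_pdivrMr ?ltr0n// mulrAC ler_pdivlMr ?ltr0n// mul1r -natrM ler_nat.
have := g_gt0 0%N => g0 gn; split; last by nia.
rewrite -(leq_pmul2l g0); lia.
Qed.

Lemma frac_le_half (R : realType) (c N k : nat) : (0 < N)%N ->
  (2 ^ k.+1 * c <= N)%N -> c%:R / N%:R <= (2 ^ k.+1)%:R^-1 :> R.
Proof.
move=> N_gt0 cN; rewrite ler_pdivrMr ?ltr0n// mulrC.
rewrite ler_pdivlMr ?ltr0n ?expn_gt0//.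
by rewrite -natrM ler_nat mulnC.
Qed.

(** The union of the blocks: their [phi_g]-sizes are summable, and the [k]-th
    one alone has [phi_h]-size at least [k + 1]. *)
Lemma exists_Exh_not_Fin (R : realType) (g h : nat -> nat) :
  calG R g -> calG R h -> (forall D, exists n, (D * h n <= g n)%N) ->
  exists2 C, Exh (phi_ R g) C & ~ Fin (phi_ R h) C.
Proof.
move=> gG [h_gt0 _ _ _ _] sparse; have [g_gt0 _ _ _ _] := gG.
have [n_ n_P] := exists_sparse _ _ _ gG sparse.
pose c k := (k.+1 * h (n_ k))%N.
have c_le k : ((c k).*2 <= (n_ k).+1)%N.
  by have [+ _] := n_P k; apply: leq_trans; rewrite leq_pmull// expn_gt0.
pose B k := block (n_ k) (c k).
have phi_sub := phi_submeasure R g; have [_ phi_ge0 _ _ _] := phi_sub.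
exists (\bigcup_k B k).
  rewrite Exh_indic; last exact: phi_np_lsc_submeasure.
  apply: (EXH_hump _ _ _ (fun=> 1) B (fun k => (n_ k).+1)) => //.
  - move=> i; rewrite indicE; case: (boolP (_ \in _)) => [|_]; last first.
      by rewrite normr0 nneseries_ge0// => k _ _; rewrite lee_fin mulr_ge0.
    rewrite inE => -[k _ Bki]; rewrite normr1.
    apply: le_trans (nneseries_term_le _ _ k _) => [|j].
      by rewrite indicE mem_set// mulr1.
    by rewrite lee_fin mulr_ge0.
  - by move=> k _ [j _ <-] /=; rewrite ltnS leq_subr.
  - apply: le_lt_trans (ltry 1); apply: nneseries_half_le => k.
      by rewrite mule_ge0.
    rewrite mul1e; apply: le_trans (phi_block_le _ _ _ _ gG (c_le k)) _.
    by rewrite lee_fin frac_le_half//; have [] := n_P k.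
apply: not_lty_of_nat_le => k.
have cn : (c k <= (n_ k).+1)%N.
  by apply: leq_trans (c_le k); rewrite -addnn leq_addr.
apply: (@le_trans _ _ (phi_ R h (B k))).
  apply: le_trans (phi_block_ge _ _ _ _ cn); rewrite lee_fin natrM.
  by rewrite mulfK ?pnatr_eq0 -?lt0n// ler_nat.
have [[_ _ _ phi_mono _] _ _] := phi_np_lsc_submeasure R h.
have /setUidr <- : B k `<=` \bigcup_k B k by exact: bigcup_sup.
exact: phi_mono.
Qed.

(** Height of the [k]-th hump; on [n_ k + 1] indices it has total mass
    [(k + 1) * h (n_ k)], the number of elements of the corresponding block. *)
Definition height (R : realType) (h n_ : nat -> nat) (k : nat) : R :=
  (k.+1 * h (n_ k))%:R / (n_ k).+1%:R.

Lemma height_le (R : realType) (g h n_ : nat -> nat) :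
  sparse_spec g h n_ -> forall k, 0 <= height R h n_ k <= (2 ^ k.+1)%:R^-1.
Proof.
move=> n_P k; rewrite divr_ge0//= frac_le_half//; have [+ _] := n_P k.
by apply: leq_trans; rewrite leq_mul2l -addnn leq_addr orbT.
Qed.

Lemma height_g_le (R : realType) (g h n_ : nat -> nat) :
  sparse_spec g h n_ -> forall k, (0 < g (n_ k))%N ->
  height R h n_ k * ((n_ k).+1%:R / (g (n_ k))%:R) *+ 2 <= (2 ^ k.+1)%:R^-1.
Proof.
move=> n_P k g_gt0; rewrite mulrA divfK ?pnatr_eq0// -mulrnAl -mulrnA muln2.
by rewrite frac_le_half//; have [] := n_P k.
Qed.

Lemma height_h (R : realType) (h n_ : nat -> nat) k : (0 < h (n_ k))%N ->
  height R h n_ k * ((n_ k).+1%:R / (h (n_ k))%:R) = k.+1%:R.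
Proof.
move=> h_gt0; rewrite mulrA divfK ?pnatr_eq0// natrM.
by rewrite mulfK ?pnatr_eq0 -?lt0n.
Qed.

Lemma hat_height_ge (R : realType) (h n_ : nat -> nat) (x : nat -> R) :
  (forall n, 0 < h n)%N ->
  (forall k i, (i <= n_ k)%N -> height R h n_ k <= `|x i|) ->
  forall k, ((k%:R)%:E <= hat (phi_ R h) x)%E.
Proof.
move=> h_gt0 x_ge k.
apply: (@le_trans _ _
    ((height R h n_ k)%:E * phi_measure R h (n_ k) `I_(n_ k).+1)%E).
  by rewrite phi_measure_initial -EFinM height_h// lee_fin ler_nat.
apply: hat_ge => [||i /=]; [exact: phi_measure_dominated|exact: divr_ge0|].
exact: x_ge.
Qed.

Lemma exists_mEXH_not_FIN (R : realType) (g h : nat -> nat) :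
  calG R g -> calG R h -> (forall D, exists n, (D * h n <= g n)%N) ->
  exists2 x, mEXH (phi_ R g) x & ~ FIN (phi_ R h) x.
Proof.
move=> gG [h_gt0 _ _ _ _] sparse; have [g_gt0 _ _ _ _] := gG.
have [n_ n_P] := exists_sparse _ _ _ gG sparse.
pose a := height R h n_.
have a_le : forall k, 0 <= a k <= (2 ^ k.+1)%:R^-1 := height_le _ _ _ _ n_P.
have a_ge0 k : 0 <= a k by case/andP: (a_le k).
pose E k : set nat := `I_(n_ k).+1.
have phi_sub := phi_submeasure R g; have [_ phi_ge0 _ _ _] := phi_sub.
exists (staircase a E).
  split; last first.
    move=> i; rewrite !ger0_norm ?staircase_ge0//.
    by apply: le_staircase => // k /=; exact: ltnW.
  apply: (EXH_hump _ _ _ a E (fun k => (n_ k).+1)) => //.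
  - by move=> i; rewrite ger0_norm ?staircase_ge0// staircaseE.
  - by move=> k; exact: subset_refl.
  apply: le_lt_trans (ltry 1); apply: nneseries_half_le => k.
    by rewrite mule_ge0 ?lee_fin.
  have aE := @phi_le_card R g (n_ k) (E k) gG (card_lexx _).
  apply: le_trans (lee_wpmul2l _ aE) _; first by rewrite lee_fin.
  rewrite -EFinM lee_fin; apply: le_trans (height_g_le R _ _ _ n_P k (g_gt0 _)).
  by rewrite mulr2n lerDl mulr_ge0// divr_ge0.
apply/not_lty_of_nat_le/(@hat_height_ge _ _ n_) => // k i ik.
by rewrite ger0_norm ?staircase_ge0// staircase_ge.
Qed.

(** Two nondegenerate intervals with the same right (or left) endpoint overlap
    near it, so the endpoint determines the index. *)
Lemma card_endpoints_le (R : realType) (J : nat -> R * R) (E : set R) :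
  nonoverlapping J ->
  ([set i | (J i).1 < (J i).2 /\ E (J i).2] #<= E)%card /\
  ([set i | (J i).1 < (J i).2 /\ E (J i).1] #<= E)%card.
Proof.
move=> [J01 J_triv].
have inJ i z : (J i).1 < z < (J i).2 -> (`[(J i).1, (J i).2] : set R)° z.
  by rewrite interior_itv_bnd /= in_itv.
have J_inj i j z : (J i).1 < z < (J i).2 -> (J j).1 < z < (J j).2 -> i = j.
  by move=> zi zj; apply: J_triv => //; exists z; split; exact: inJ.
split.
  rewrite -(card_le_eql (inj_card_eq (f := fun i => (J i).2) _)).
    by apply: subset_card_le => _ [i [_ Ei] <-].
  move=> i j; rewrite !inE /= => -[it _] [jt _] ij.
  have [z] : exists z, (J i).1 < z < (J i).2 /\ (J j).1 < z < (J j).2.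
    exists ((Num.max (J i).1 (J j).1 + (J i).2) / 2).
    rewrite -ij in jt *.
    by have [ij1|ij1] := leP (J i).1 (J j).1; split; apply/andP; split; lra.
  by case; exact: J_inj.
rewrite -(card_le_eql (inj_card_eq (f := fun i => (J i).1) _)).
  by apply: subset_card_le => _ [i [_ Ei] <-].
move=> i j; rewrite !inE /= => -[it _] [jt _] ij.
have [z] : exists z, (J i).1 < z < (J i).2 /\ (J j).1 < z < (J j).2.
  exists (((J i).1 + Num.min (J i).2 (J j).2) / 2).
  rewrite -ij in jt *.
  by have [ij1|ij1] := leP (J i).2 (J j).2; split; apply/andP; split; lra.
by case; exact: J_inj.
Qed.

(** The function takes the values of the sequence of the previous construction
    at the points [1 / (2i+1)] and vanishes elsewhere, in particular at the
    points [1 / (2i+2)]. *)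
Lemma exists_BVar_not_BVar (R : realType) (g h : nat -> nat) :
  calG R g -> calG R h -> (forall D, exists n, (D * h n <= g n)%N) ->
  exists2 x, BVar (phi_ R g) x & ~ BVar (phi_ R h) x.
Proof.
move=> gG [h_gt0 _ _ _ _] sparse; have [g_gt0 _ _ _ _] := gG.
have [n_ n_P] := exists_sparse _ _ _ gG sparse.
pose a := height R h n_.
have a_le : forall k, 0 <= a k <= (2 ^ k.+1)%:R^-1 := height_le _ _ _ _ n_P.
have a_ge0 k : 0 <= a k by case/andP: (a_le k).
pose p (i : nat) : R := i.+1%:R^-1.
pose E k : set R := (fun i => p i.*2) @` `I_(n_ k).+1.
have phi_sub := phi_submeasure R g; have [_ phi_ge0 _ _ phi_U] := phi_sub.
pose x := staircase a E.
have x_ge0 t : 0 <= x t by exact: staircase_ge0.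
exists x.
  split.
    exists 1; split; first by rewrite num_real.
    move=> M M1 t _ /=; rewrite ger0_norm//.
    by apply: le_trans (ltW M1); exact: staircase_le1.
  apply: le_lt_trans (ltry 1); apply: ge_ereal_sup => _ [J JP <-].
  have [cardr cardl] := (fun E => (card_endpoints_le R J E JP).1,
                         fun E => (card_endpoints_le R J E JP).2).
  (* Indices of the intervals ending, respectively starting, at a point of the
     [k]-th hump; a degenerate interval has no increment. *)
  pose Ar k := [set i | (J i).1 < (J i).2 /\ E k (J i).2].
  pose Al k := [set i | (J i).1 < (J i).2 /\ E k (J i).1].
  have cardE k : (E k #<= `I_(n_ k).+1)%card by exact: card_image_le.
  have phiA k : (phi_ R g (Ar k `|` Al k) <=
      (((n_ k).+1%:R / (g (n_ k))%:R) *+ 2)%:E)%E.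
    apply: le_trans (phi_U _ _) _; rewrite mulr2n EFinD.
    apply: leeD; apply: phi_le_card => //; apply: card_le_trans (cardE k).
      exact: cardr.
    exact: cardl.
  apply: le_trans
    (@hat_le_series _ _ _ a (fun k => Ar k `|` Al k) _ _ _) _ => //.
    move=> i; rewrite -staircaseE// lee_fin /increments normr_id.
    have [_ + _] := JP.1 i; rewrite le_eqVlt => /orP[/eqP ->|Ji].
      by rewrite subrr normr0 staircase_ge0.
    (* Both endpoint values are nonnegative, so their difference is bounded by
       the larger one. *)
    have x1 : x (J i).1 <= staircase a (fun k => Ar k `|` Al k) i.
      by apply: le_staircase => // k Ek; right.
    have x2 : x (J i).2 <= staircase a (fun k => Ar k `|` Al k) i.
      by apply: le_staircase => // k Ek; left.
    have := x_ge0 (J i).1; have := x_ge0 (J i).2.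
    by rewrite ler_norml => ? ?; apply/andP; split; lra.
  apply: nneseries_half_le => k; first by rewrite mule_ge0 ?lee_fin.
  apply: le_trans (lee_wpmul2l _ (phiA k)) _; first by rewrite lee_fin.
  rewrite -EFinM lee_fin mulrnAr; exact: height_g_le.
case=> _.
have p_le i j : (p i <= p j) = (j <= i)%N.
  by rewrite lef_pV2 ?posrE ?ltr0n// ler_nat ltnS.
have p_inj : injective p.
  by move=> i j /invr_inj /eqP; rewrite eqr_nat => /eqP[].
pose J i := (p i.*2.+1, p i.*2).
have J_in : nonoverlapping J.
  split => [i|].
    split => /=; rewrite ?p_le// ?invr_ge0//.
    by rewrite invf_le1 ?ltr0n// ler1n.
  have J_disj i j z : (i < j)%N -> p i.*2.+1 < z -> z < p j.*2 -> False.
    move=> ij iz zj; have := lt_trans iz zj; rewrite ltNge p_le.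
    by rewrite (_ : _ <= _)%N//; lia.
  apply/trivIsetP => i j _ _ /eqP ij; apply/seteqP; split => // z [].
  rewrite !interior_itv_bnd /= !in_itv /= => /andP[iz zi] /andP[jz zj].
  have [ij'|ij'] : (i < j \/ j < i)%N by lia.
    exact: J_disj ij' iz zj.
  exact: J_disj ij' jz zi.
apply: not_lty_of_nat_le => k.
apply: (@le_trans _ _ (hat (phi_ R h) (increments x J))); last first.
  by apply: ereal_sup_ubound; exists J.
apply: (@hat_height_ge _ _ n_) => // {}k i ik.
rewrite /increments normr_id /= [X in _ - X]staircase_eq0 => [|j [l _ /p_inj]].
  rewrite subr0 ger0_norm//; apply: staircase_ge => //.
  by exists i.
by move=> /(congr1 odd) /=; rewrite !odd_double.
Qed.

(** * The equivalences *)

(** On the constant sequence 1 of length [n + 1] the two extensions take the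
    values [(n + 1) / g n] and [(n + 1) / h n], with quotient [g n / h n]. *)
Lemma preceq_m_ratio (R : realType) (g h : nat -> nat) :
  calG R g -> (forall n, 0 < h n)%N -> preceq_m (phi_ R h) (phi_ R g) ->
  exists2 eta : R, 0 < eta & forall n, (g n)%:R / (h n)%:R <= eta.
Proof.
move=> gG h_gt0 [M M_gt0 gh]; have [g_gt0 _ _ _ _] := gG; exists M => // n.
pose u : n.+1.-tuple R := [tuple of nseq n.+1 1].
have uE : zero_ext u = \1_(`I_n.+1).
  apply/funext => i; rewrite -[LHS]/(nth 0 (nseq n.+1 1) i) nth_nseq indicE.
  by case: ifPn => ni; [rewrite mem_set|rewrite memNset//; exact/negP].
have u_mon (i j : 'I_n.+1) : (i <= j)%N -> `|tnth u j| <= `|tnth u i|.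
  by rewrite /tnth -/(nseq n.+1 1) !nth_nseq !ltn_ord.
have := gh n u u_mon; rewrite uE !hat_indic; try exact: phi_np_lsc_submeasure.
have M_ge0 : (0 <= M%:E)%E by rewrite lee_fin ltW.
have phi_g_le := @phi_le_card R g n `I_n.+1 gG (card_lexx _).
move=> /le_trans/(_ (lee_wpmul2l M_ge0 phi_g_le)).
move=> /(le_trans (phi_measure_dominated R h n _)).
rewrite phi_measure_initial -EFinM lee_fin.
rewrite mulrCA ler_pM2l ?ltr0n// ler_pdivlMr ?ltr0n//.
by rewrite mulrC.
Qed.

Theorem theorem5p1 (R : realType) (g h : nat -> nat)
    (hg : calG R g) (hh : calG R h) :
  [<-> (* a *) exists2 eta : R, 0 < eta &
                 forall n, (g n)%:R / (h n)%:R <= eta;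
       (* b *) preceq (phi_ R h) (phi_ R g);
       (* c *) preceq_m (phi_ R h) (phi_ R g);
       (* d *) Fin (phi_ R g) `<=` Fin (phi_ R h);
       (* e *) Exh (phi_ R g) `<=` Exh (phi_ R h);
       (* f *) Exh (phi_ R g) `<=` Fin (phi_ R h);
       (* g *) FIN (phi_ R g) `<=` FIN (phi_ R h);
       (* h *) EXH (phi_ R g) `<=` EXH (phi_ R h);
       (* i *) EXH (phi_ R g) `<=` FIN (phi_ R h);
       (* j *) mFIN (phi_ R g) `<=` mFIN (phi_ R h);
       (* k *) mEXH (phi_ R g) `<=` mEXH (phi_ R h);
       (* l *) mEXH (phi_ R g) `<=` mFIN (phi_ R h);
       (* m *) BVar (phi_ R g) `<=` BVar (phi_ R h)].
Proof.
have [g_gt0 _ _ _ _] := hg; have [h_gt0 _ _ _ _] := hh.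
have g_np := phi_np_lsc_submeasure R g; have h_np := phi_np_lsc_submeasure R h.
have [[g_sub _ _] [h_sub _ _]] := (g_np, h_np).
set A := (X in all_iff X _).
have hat_le : A -> exists2 eta : R, 0 < eta &
    forall x, (hat (phi_ R h) x <= eta%:E * hat (phi_ R g) x)%E.
  move=> [eta eta_gt0 gh]; exists eta => // x.
  by apply: hat_scale => // C; exact: phi_scale.
have A_FIN : A -> FIN (phi_ R g) `<=` FIN (phi_ R h).
  move=> /hat_le[eta eta_gt0 gh] x; rewrite /FIN /= => gx.
  apply: le_lt_trans (gh x) _.
  by rewrite lte_mul_pinfty ?lee_fin ?ltW.
have A_EXH : A -> EXH (phi_ R g) `<=` EXH (phi_ R h).
  move=> /hat_le[eta eta_gt0 gh] x; rewrite /EXH /= => x_exh.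
  apply/cvge0P => [n|e e_gt0]; first exact: hat_ge0.
  move/cvge0P: x_exh.
  move=> /(_ (fun=> hat_ge0 _ _ _ g_sub) _ (divr_gt0 e_gt0 eta_gt0)).
  apply: filterS => n n_le; apply: le_trans (gh _) _.
  by rewrite -lee_pdivlMl// -EFinM mulrC.
have f_A : Exh (phi_ R g) `<=` Fin (phi_ R h) -> A.
  have [//|gap] := ratio_bounded_or_sparse R g h h_gt0.
  by have [C gC hC] := exists_Exh_not_Fin _ _ _ hg hh gap => /(_ C gC).
have l_A : mEXH (phi_ R g) `<=` mFIN (phi_ R h) -> A.
  have [//|gap] := ratio_bounded_or_sparse R g h h_gt0.
  by have [x gx hx] := exists_mEXH_not_FIN _ _ _ hg hh gap => /(_ x gx)[].
have m_A : BVar (phi_ R g) `<=` BVar (phi_ R h) -> A.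
  have [//|gap] := ratio_bounded_or_sparse R g h h_gt0.
  by have [x gx hx] := exists_BVar_not_BVar _ _ _ hg hh gap => /(_ x gx).
have g_EXH : EXH (phi_ R g) `<=` FIN (phi_ R g) by exact: EXH_FIN.
have h_EXH : EXH (phi_ R h) `<=` FIN (phi_ R h) by exact: EXH_FIN.
have g_Exh : Exh (phi_ R g) `<=` Fin (phi_ R g).
  by move=> C; rewrite Exh_indic// Fin_indic//; exact: EXH_FIN.
have h_Exh : Exh (phi_ R h) `<=` Fin (phi_ R h).
  by move=> C; rewrite Exh_indic// Fin_indic//; exact: EXH_FIN.
have i_l : EXH (phi_ R g) `<=` FIN (phi_ R h) ->
  mEXH (phi_ R g) `<=` mFIN (phi_ R h) by move=> gh x [/gh].
(* A link that is not a mere restriction of the class on the left or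
   enlargement of the one on the right goes back through the bounded ratio. *)
tfae.
- by move=> /hat_le[eta eta_gt0 gh]; exists eta.
- by move=> [M M_gt0 gh]; exists M.
- by move=> /(preceq_m_ratio _ _ _ hg h_gt0)/A_FIN gh C;
    rewrite !Fin_indic//; exact: gh.
- move=> gh; have /f_A/A_EXH gh' : Exh (phi_ R g) `<=` Fin (phi_ R h).
    by apply: subset_trans gh.
  by move=> C; rewrite !Exh_indic//; exact: gh'.
- by move=> gh; exact: subset_trans gh _.
- by move=> /f_A/A_FIN.
- by move=> gh; apply/A_EXH/l_A/i_l; exact: subset_trans gh.
- by move=> gh; exact: subset_trans gh _.
- by move=> /i_l/l_A/A_FIN gh x [/gh].
- move=> gh; have /l_A/A_EXH gh' : mEXH (phi_ R g) `<=` mFIN (phi_ R h).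
    by move=> x [/g_EXH gx mx]; exact: gh.
  by move=> x [/gh'].
- by move=> gh x /gh[/h_EXH].
- move=> /l_A/hat_le[eta eta_gt0 gh] x [x_bnd gx]; split => //.
  rewrite (@le_lt_trans _ _ (eta%:E *
      ereal_sup
        [set hat (phi_ R g) (increments x J) | J in @nonoverlapping R])%E)//.
    apply: ge_ereal_sup => _ [J JP <-]; apply: le_trans (gh _) _.
    apply: lee_wpmul2l; first by rewrite lee_fin ltW.
    by apply: ereal_sup_ubound; exists J.
  by rewrite lte_mul_pinfty// lee_fin ltW.
- exact: m_A.
Qed.
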